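(* If the reference distribution $P_0$ is regular, then for each $c\in[0,\Pi_0]$ there are at most two posted prices, denoted $u(c)$ and $w(c)$ (with $u(c)\le w(c)$), that yield the same revenue $c$, i.e., that solve $\mathcal R_{P_0}(p)=c$. Furthermore, $\frac{w(c)}{u(c)}$ decreases with $c$, which ensures that for every $k>0$ there is a unique $c^*(k)$ satisfying $\frac{w(c^*(k))}{u(c^*(k))}=\frac{k+1}{k}$, and for any $k>0$, $p^{PP*}(k)=u(c^*(k))$.
   Context: $P_0$ is a continuous probability distribution supported on $[0,1]$ with CDF $P_0$ and density $p_0$. It is called regular if its virtual valuation $x-\frac{1-P_0(x)}{p_0(x)}$ is strictly increasing in $x$. $\mathcal R_{P_0}(p)=p\,(1-P_0(p))$ is the expected revenue at posted price $p$, and $\Pi_0=\max_{p\in[0,1]}\mathcal R_{P_0}(p)$. When there is only one price yielding revenue $c$, $u(c)=w(c)$; if $u(c)=0<w(c)$, the ratio $w(c)/u(c)$ is $+\infty$. For $k>0$, the fragility-adjusted revenue at price $p$ is $$\rho^{PP}(p,k):=\int_{(1+\frac1k)p}^1p\,\mathrm dP_0(v)+k\int_p^{(1+\frac1k)p}(v-p)\,\mathrm dP_0(v)=\mathbb E_{P_0}\left[\min\{p,k(\tilde v-p)^+\}\right],$$ where $\tilde v\sim P_0$ and $y^+=\max\{y,0\}$, and $p^{PP*}(k):=\arg\max_{p\in[0,1]}\rho^{PP}(p,k)$. *)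

(* Defs.v *)
From HB Require Import structures.
From mathcomp Require Import all_boot all_order all_algebra.
From mathcomp Require Import all_classical all_reals all_analysis.
Set Implicit Arguments.
Unset Strict Implicit.
Unset Printing Implicit Defensive.
Import Order.TTheory GRing.Theory Num.Theory.
Import numFieldNormedType.Exports.
Local Open Scope classical_set_scope.
Local Open Scope ring_scope.

Section PostedPrice.
Context {R : realType} (P0 : probability (measurableTypeR R) R).

(* Density with respect to Lebesgue measure; no continuity of [p0] is assumed. *)
Definition is_density (p0 : R -> R) : Prop :=
  [/\ measurable_fun setT p0,
      forall x, 0 <= p0 x
    & forall A : set R, measurable A ->
        P0 A = (\int[@lebesgue_measure R]_(x in A) (p0 x)%:E)%E].

Definition CDF (x : R) : R := fine (P0 `]-oo, x]%classic).

Definition virtual_valuation (p0 : R -> R) (x : R) : R := x - (1 - CDF x) / p0 x.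

(* Positivity of [p0] is what makes the virtual valuation well defined (division
   by 0 is total here). The endpoints 0 and 1 are left out, so that densities
   vanishing there, such as 2x or 2(1 - x), are covered. *)
Definition regular (p0 : R -> R) : Prop :=
  (forall x, 0 < x < 1 -> 0 < p0 x) /\
  (forall x y, 0 < x -> x < y -> y < 1 ->
     virtual_valuation p0 x < virtual_valuation p0 y).

Definition revenue (p : R) : R := p * (1 - CDF p).

(* The supremum is a maximum as soon as [prices max_revenue] below is
   nonempty. *)
Definition max_revenue : R := sup (revenue @` `[0, 1]%classic).

Definition prices (c : R) : set R :=
  [set p | 0 <= p <= 1 /\ revenue p = c].

Definition price_ratio (u w : R -> R) (c : R) : \bar R :=
  if (u c == 0) && (0 < w c) then +oo%E else (w c / u c)%:E.

(* When (1 + 1/k) p > 1 the first integral is over the empty set; the shared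
   endpoint carries no mass for a distribution with a density. *)
Definition fragility_revenue (p k : R) : R :=
  \int[P0]_(v in `[(1 + k^-1) * p, 1]%classic) p
  + k * \int[P0]_(v in `[p, (1 + k^-1) * p]%classic) (v - p).

Definition argmax_price (k : R) : set R :=
  [set p | 0 <= p <= 1 /\
     forall q, 0 <= q <= 1 -> fragility_revenue q k <= fragility_revenue p k].

End PostedPrice.

(* Main.v *)
Require Import Defs.
From HB Require Import structures.
From mathcomp Require Import all_boot all_order all_algebra.
From mathcomp Require Import all_classical all_reals all_analysis.
From mathcomp Require Import measurable_realfun ring lra.
Import Order.TTheory GRing.Theory Num.Theory.
Import numFieldNormedType.Exports.
Set Implicit Arguments.
Unset Strict Implicit.
Local Open Scope classical_set_scope.
Local Open Scope ring_scope.

(** Write F for the distribution function, S = 1 - F for the survival function,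
    phi for the virtual valuation and a = 1 + 1/k.

    Revenue is R(p) = p S(p), and dR = - phi dF: measured against the
    probability of no sale, revenue has slope - phi. Regularity makes this
    slope strictly decreasing, so R rises strictly up to some peak m in ]0, 1[
    and falls strictly afterwards, from R(0) = 0 and back to R(1) = 0
    ([revenue_unimodal]). Each level c is therefore reached once on each side
    of m, at u(c) <= m <= w(c), where u increases and w decreases with c; hence
    the ratio w/u decreases.

    The fragility-adjusted revenue rho(p) = E[min(p, k (v - p)^+)] has
    derivative (k + 1) S(a p) - k S(p), since a marginal increase of p gains 1
    when v > a p and loses k when p < v < a p. Multiplied by p, this
    derivative equals k (R(a p) - R(p)) ([revenue_gap]). So the sign of rho'
    compares the revenues at p and at a p. Unimodality yields a unique h with
    R(h) = R(a h), with R(p) < R(a p) before h and R(a p) < R(p) after it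
    ([unimodal_crossing]). Hence h is the only maximizer of rho
    ([fragility_maximum]), and h = u(c), a h = w(c) for c = R(h), which is the
    level where the ratio of the two prices equals a.

    The density is only measurable, so F is continuous but need not be
    differentiable, and the identity for dR cannot be read as a derivative.
    Monotonicity is instead derived from bounds on increments, which hold up
    to an error (t - s) (F(t) - F(s)) on [s, t]; such second-order errors
    vanish under repeated bisection ([le_of_bisection]). *)

(** * Monotonicity from increments *)

(** Splitting [s, t] at its midpoint bounds the error by
    (t - s) / 2 * (g t - g s), half of the original bound. Iterating makes the
    bound arbitrarily small. *)
Lemma le_of_bisection {R : realType} (f g : R -> R) (x y : R) : x <= y ->
  (forall s t, x <= s -> s <= t -> t <= y ->
     f s - f t <= (t - s) * (g t - g s)) ->
  f x <= f y.
Proof.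
move=> xy fg.
have halving n s t : x <= s -> s <= t -> t <= y ->
    f s - f t <= 2^-1 ^+ n * ((t - s) * (g t - g s)).
  elim: n s t => [|n IHn] s t xs st ty; first by rewrite expr0 mul1r; exact: fg.
  have sm : s <= (s + t) / 2 by lra.
  have mt : (s + t) / 2 <= t by lra.
  have := IHn s ((s + t) / 2) xs sm (le_trans mt ty).
  have := IHn ((s + t) / 2) t (le_trans xs sm) mt ty.
  set q := 2^-1 ^+ n; set z := (s + t) / 2.
  rewrite (_ : t - z = (t - s) / 2); last by rewrite /z; field.
  rewrite (_ : z - s = (t - s) / 2); last by rewrite /z; field.
  rewrite exprSr -/q.
  have -> : q * 2^-1 * ((t - s) * (g t - g s)) =
    q * ((t - s) / 2 * (g t - g z)) + q * ((t - s) / 2 * (g z - g s)) by field.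
  lra.
rewrite -subr_le0.
set C := (y - x) * (g y - g x).
have cvg0 : 2^-1 ^+ n * C @[n --> \oo] --> (0 : R).
  rewrite -[0](mul0r C); apply: cvgM; last exact: cvg_cst.
  by apply: cvg_expr; rewrite ger0_norm//; lra.
rewrite -(cvg_lim (@Rhausdorff R) cvg0).
apply: limr_ge; first by apply/cvg_ex; exists 0.
by near=> n; exact: halving.
Unshelve. all: by end_near. Qed.

(** * The distribution function *)

Section distribution_function.
Context {R : realType} (P0 : probability (measurableTypeR R) R) (p0 : R -> R).
Local Notation mu := (@lebesgue_measure R).

Lemma CDF_le1 x : CDF P0 x <= 1.
Proof.
by rewrite -lee_fin fineK ?probability_le1// fin_num_measure.
Qed.

Lemma measure_itv_oc s t : s <= t ->
  P0 `]s, t]%classic = (CDF P0 t - CDF P0 s)%:E.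
Proof.
move=> st; rewrite EFinB /CDF !fineK ?fin_num_measure//.
have -> : `]s, t]%classic = `]-oo, t]%classic `\` `]-oo, s]%classic :> set R.
  apply/seteqP; split => x /=; rewrite !in_itv/=.
    by move=> /andP[sx ->]; split => //; apply/negP; rewrite -ltNge.
  by move=> [-> /negP]; rewrite -ltNge => ->.
rewrite measureD//; last by rewrite ltey_eq fin_num_measure.
by rewrite setIidr//; apply: subset_itvl; rewrite bnd_simp.
Qed.

Lemma CDF_homo : {homo CDF P0 : x y / x <= y}.
Proof.
by move=> x y xy; rewrite -subr_ge0 -lee_fin -measure_itv_oc.
Qed.

Lemma measure_itv_oy x : P0 `]x, +oo[%classic = (1 - CDF P0 x)%:E.
Proof.
rewrite EFinB /CDF !fineK ?fin_num_measure//.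
by rewrite -setCitvl probability_setC.
Qed.

Context (hdens : is_density P0 p0).

Lemma density_integrable A : measurable A -> mu.-integrable A (EFin \o p0).
Proof.
case: hdens => mp p_ge0 Pint mA.
apply: (@integrableS _ _ _ _ setT) => //; apply/integrableP; split.
  exact/measurable_EFinP.
under eq_integral do rewrite /= ger0_norm//.
by rewrite -Pint// probability_setT ltey.
Qed.

Lemma measure_itv_cc s t : s <= t ->
  P0 `[s, t]%classic = (CDF P0 t - CDF P0 s)%:E.
Proof.
case: hdens => mp _ Pint st; rewrite -measure_itv_oc// !Pint//.
by rewrite integral_itv_obnd_cbnd//; exact/measurable_EFinP/measurable_funTS.
Qed.

(** Absolute continuity of the integral of the density: intervals of small
    length carry little mass. *)
Lemma CDF_continuous : continuous (CDF P0).
Proof.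
case: hdens => mp p_ge0 Pint x.
apply/cvgrPdist_lt => e e0.
have [d [d0 dP]] := @integral_normr_continuous _ _ _ _ _
  (density_integrable measurableT) e e0.
have close s t : s <= t -> t - s < d -> CDF P0 t - CDF P0 s < e.
  move=> st std.
  have mu_st : (mu `]s, t]%classic < d%:E)%E.
    rewrite lebesgue_measure_itv/= lte_fin.
    by case: ifP => _; rewrite -?EFinB lte_fin.
  have := dP `]s, t]%classic (measurable_itv _) mu_st.
  apply: le_lt_trans.
  rewrite -lee_fin -measure_itv_oc// Pint// /Rintegral fineK.
    under [leRHS]eq_integral do rewrite ger0_norm//.
    by [].
  apply: integrable_fin_num => //.
  exact: (integrable_abse (density_integrable (measurable_itv _))).
near=> y.
have xyd : `|x - y| < d by near: y; exists d.
have [xy|/ltW yx] := leP x y.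
  rewrite distrC ger0_norm ?subr_ge0 ?CDF_homo//; apply: close => //.
  by rewrite distrC ger0_norm ?subr_ge0 in xyd.
rewrite ger0_norm ?subr_ge0 ?CDF_homo//; apply: close => //.
by rewrite ger0_norm ?subr_ge0 in xyd.
Unshelve. all: by end_near. Qed.

(** [a] and [b] may have any sign, so that the same statement bounds the mass of
    an interval from above and from below. *)
Lemma CDF_increment_le (a b s t : R) : s <= t ->
  (forall v, s < v < t -> a * p0 v <= b) ->
  a * (CDF P0 t - CDF P0 s) <= b * (t - s).
Proof.
case: hdens => mp p_ge0 Pint st ab.
have mu_st : mu `]s, t[%classic = (t - s)%:E.
  rewrite lebesgue_measure_itv/= lte_fin.
  case: ltP => [_|ts]; first by rewrite EFinB.
  by rewrite (_ : t - s = 0)//; apply/eqP; rewrite subr_eq0 eq_le ts st.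
have -> : CDF P0 t - CDF P0 s = \int[mu]_(v in `]s, t[) p0 v.
  rewrite -[LHS]/(fine (_%:E)) -measure_itv_oc// Pint//.
  rewrite /Rintegral -integral_itv_bndo_bndc//.
  exact/measurable_EFinP/measurable_funTS.
rewrite -RintegralZl ?density_integrable//.
rewrite (_ : t - s = fine (mu `]s, t[%classic)); last by rewrite mu_st.
rewrite -Rintegral_cst//; apply: le_Rintegral => //.
- have : mu.-integrable `]s, t[ (fun x => a%:E * (p0 x)%:E)%E.
    exact: integrableZl (density_integrable (measurable_itv _)).
  by [].
- apply/integrableP; split; first exact: measurable_cst.
  by rewrite integral_cst//= mu_st -EFinM ltey.
Qed.

Lemma CDF_lt s t : s < t -> (forall v, s < v < t -> 0 < p0 v) ->
  CDF P0 s < CDF P0 t.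
Proof.
case: hdens => mp p_ge0 Pint st p_gt0.
rewrite lt_neqAle CDF_homo ?(ltW st)// andbT; apply/eqP => Fst.
have int0 : (\int[mu]_(v in `]s, t[) `|(EFin \o p0) v| = 0)%E.
  under eq_integral do rewrite /= ger0_norm//.
  rewrite integral_itv_bndo_bndc; last exact/measurable_EFinP/measurable_funTS.
  by rewrite -Pint// measure_itv_oc ?(ltW st)// Fst subrr.
have mp_st : measurable_fun `]s, t[ (EFin \o p0).
  exact/measurable_EFinP/measurable_funTS.
have [N [mN N0 stN]] := (ae_eq_integral_abs mu (measurable_itv _) mp_st).1 int0.
have : (mu `]s, t[%classic <= mu N)%E.
  apply: le_measure; rewrite ?inE//; apply: subset_trans stN => v /= stv pv0.
  have /p_gt0 : s < v < t by move: stv; rewrite in_itv.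
  by have [->] := pv0 stv; rewrite ltxx.
rewrite lebesgue_measure_itv/= lte_fin st -EFinB N0 lee_fin.
lra.
Qed.
End distribution_function.

(** * Revenue under a regular distribution *)

Section regular_revenue.
Context {R : realType} (P0 : probability (measurableTypeR R) R) (p0 : R -> R).
Context (hsupp : P0 `[0, 1]%classic = 1%E).
Context (hdens : is_density P0 p0).
Context (hreg : regular P0 p0).

Local Notation F := (CDF P0).
Local Notation phi := (virtual_valuation P0 p0).
Local Notation rev := (revenue P0).

Lemma CDF_eq1 x : 1 <= x -> F x = 1.
Proof.
move=> x1; apply/eqP; rewrite eq_le CDF_le1 /=.
rewrite -lee_fin -hsupp fineK ?fin_num_measure//.
apply: le_measure; rewrite ?inE// => v /=; rewrite !in_itv/=.
by move=> /andP[_ /le_trans]; apply.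
Qed.

Lemma CDF_increasing s t : 0 <= s -> s < t -> t <= 1 -> F s < F t.
Proof.
case: hreg => p_gt0 _ s0 st t1; apply: (CDF_lt hdens) => // v /andP[sv vt].
by apply: p_gt0; rewrite (le_lt_trans s0 sv) (lt_le_trans vt t1).
Qed.

Lemma CDF_lt1 s : 0 <= s < 1 -> F s < 1.
Proof.
by case/andP=> s0 s1; rewrite -[ltRHS](CDF_eq1 (lexx 1)) CDF_increasing.
Qed.

Lemma virtual_valuation_le v m : 0 < v < 1 ->
  (phi v <= m) = ((v - m) * p0 v <= 1 - F v).
Proof.
case: hreg => p_gt0 _ /p_gt0 pv.
by rewrite /virtual_valuation lerBlDr -lerBlDl ler_pdivlMr.
Qed.

Lemma virtual_valuation_ge v m : 0 < v < 1 ->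
  (m <= phi v) = (1 - F v <= (v - m) * p0 v).
Proof.
case: hreg => p_gt0 _ /p_gt0 pv.
by rewrite /virtual_valuation lerBrDr -lerBrDl ler_pdivrMr.
Qed.

(** (p - m) S(p) has slope S - (p - m) p0 = (m - phi) p0, which is nonnegative
    where phi <= m. With m = 0 this says that the revenue does not decrease.
    With m < 0 it grows strictly, because the added term - m S decreases
    strictly. *)
Lemma margin_homo m x y : 0 <= x -> x <= y -> y <= 1 ->
  (forall v, x < v < y -> phi v <= m) ->
  (x - m) * (1 - F x) <= (y - m) * (1 - F y).
Proof.
case: hdens => _ p_ge0 _ x0 xy y1 phi_le.
apply: (le_of_bisection (f := fun p => (p - m) * (1 - F p)) (g := F) xy).
move=> s t xs st ty.
(* On ]s, t[ the factor v - m is at least s - m, and S is at most S(s). *)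
have : (s - m) * (F t - F s) <= (1 - F s) * (t - s).
  apply: (CDF_increment_le hdens) => // v /andP[sv vt].
  have v01 : 0 < v < 1.
    rewrite (le_lt_trans x0 (le_lt_trans xs sv)).
    by rewrite (lt_le_trans vt (le_trans ty y1)).
  have := phi_le v; rewrite (le_lt_trans xs sv) (lt_le_trans vt ty) => /(_ isT).
  rewrite virtual_valuation_le//.
  have := CDF_homo P0 (ltW sv).
  have := p_ge0 v.
  nra.
lra.
Qed.

Lemma margin_anti m x y : 0 <= x -> x <= y -> y <= 1 ->
  (forall v, x < v < y -> m <= phi v) ->
  (y - m) * (1 - F y) <= (x - m) * (1 - F x).
Proof.
case: hdens => _ p_ge0 _ x0 xy y1 phi_ge.
rewrite -lerN2.
apply: (le_of_bisection (f := fun p => - ((p - m) * (1 - F p))) (g := F) xy).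
move=> s t xs st ty.
(* Here v - m is at most t - m, and S is at least S(t). *)
have : (m - t) * (F t - F s) <= (F t - 1) * (t - s).
  apply: (CDF_increment_le hdens) => // v /andP[sv vt].
  have v01 : 0 < v < 1.
    rewrite (le_lt_trans x0 (le_lt_trans xs sv)).
    by rewrite (lt_le_trans vt (le_trans ty y1)).
  have := phi_ge v; rewrite (le_lt_trans xs sv) (lt_le_trans vt ty) => /(_ isT).
  rewrite virtual_valuation_ge//.
  have := CDF_homo P0 (ltW vt).
  have := p_ge0 v.
  nra.
lra.
Qed.

Lemma virtual_valuation_homo x y : 0 < x -> x <= y -> y < 1 -> phi x <= phi y.
Proof.
case: hreg => _ mphi x0; rewrite le_eqVlt => /predU1P[-> //|xy] y1.
exact/ltW/mphi.
Qed.

(** At the midpoint y of x and z the virtual valuation is strictly negative, so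
    revenue grows strictly from x to y, and it does not decrease from y to z. *)
Lemma revenue_lt_of_virtual_le0 x z : 0 <= x -> x < z -> z < 1 -> phi z <= 0 ->
  rev x < rev z.
Proof.
case: hreg => _ mphi x0 xz z1 phiz.
pose y := (x + z) / 2.
have xy : x < y by rewrite /y; lra.
have yz : y < z by rewrite /y; lra.
have phiy : phi y < 0 by apply: lt_le_trans phiz; apply: mphi => //; lra.
have : (x - phi y) * (1 - F x) <= (y - phi y) * (1 - F y).
  apply: margin_homo; [lra..|] => v /andP[xv vy].
  by apply: virtual_valuation_homo; lra.
have : (y - 0) * (1 - F y) <= (z - 0) * (1 - F z).
  apply: margin_homo; [lra..|] => v /andP[yv vz].
  by apply: le_trans phiz; apply: virtual_valuation_homo; lra.
have : F x < F y by apply: CDF_increasing; lra.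
rewrite /revenue; nra.
Qed.

Lemma revenue_gt_of_virtual_ge0 z y : 0 < z -> z < y -> y <= 1 -> 0 <= phi z ->
  rev y < rev z.
Proof.
case: hreg => _ mphi z0 zy y1 phiz.
pose x := (z + y) / 2.
have zx : z < x by rewrite /x; lra.
have xy : x < y by rewrite /x; lra.
have phix : 0 < phi x by apply: le_lt_trans phiz _; apply: mphi => //; lra.
have : (y - phi x) * (1 - F y) <= (x - phi x) * (1 - F x).
  apply: margin_anti; [lra..|] => v /andP[xv vy].
  by apply: virtual_valuation_homo; lra.
have : (x - 0) * (1 - F x) <= (z - 0) * (1 - F z).
  apply: margin_anti; [lra..|] => v /andP[yv vz].
  by apply: le_trans phiz _; apply: virtual_valuation_homo; lra.
have : F x < F y by apply: CDF_increasing; lra.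
rewrite /revenue; nra.
Qed.

Lemma revenue_continuous : continuous rev.
Proof.
move=> x; rewrite /revenue; apply: cvgM; first exact: cvg_id.
apply: cvgB; first exact: cvg_cst.
exact: (CDF_continuous hdens).
Qed.

Lemma revenue_ge1 x : 1 <= x -> rev x = 0.
Proof. by move=> x1; rewrite /revenue CDF_eq1// subrr mulr0. Qed.

Lemma revenue_gt0 x : 0 < x < 1 -> 0 < rev x.
Proof.
case/andP=> x0 x1; rewrite /revenue mulr_gt0// subr_gt0 CDF_lt1//.
by rewrite (ltW x0).
Qed.

(** The peak m is a point where the continuous revenue is maximal. The virtual
    valuation is negative before m and positive after it: a point violating
    this would have a larger revenue than m. *)
Lemma revenue_unimodal : exists2 m, 0 < m < 1 &
  (forall x y, 0 <= x -> x < y -> y <= m -> rev x < rev y) /\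
  (forall x y, m <= x -> x < y -> y <= 1 -> rev y < rev x).
Proof.
have [|m] := @EVT_max _ rev 0 1 ler01.
  exact/continuous_subspaceT/revenue_continuous.
rewrite in_itv/= => /andP[m0 m1] max_m.
have {}max_m x : 0 <= x <= 1 -> rev x <= rev m.
  by move=> x01; apply: max_m; rewrite in_itv.
have revm : 0 < rev m.
  apply: lt_le_trans (@revenue_gt0 2^-1 _) (max_m _ _); lra.
have {}m0 : 0 < m.
  rewrite lt_neqAle m0 andbT; apply: contraTneq revm => <-.
  by rewrite /revenue mul0r ltxx.
have {}m1 : m < 1.
  rewrite lt_neqAle m1 andbT; apply: contraTneq revm => ->.
  by rewrite revenue_ge1 ?ltxx.
exists m; first by rewrite m0.
split=> [x y x0 xy ym|x y mx xy y1].
- pose z := (x + y) / 2.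
  have phi_lt0 v : 0 < v -> v < m -> phi v < 0.
    move=> v0 vm; rewrite ltNge; apply/negP => /revenue_gt_of_virtual_ge0.
    by move=> /(_ m v0 vm (ltW m1)); rewrite ltNge max_m//; lra.
  have xz : x < z by rewrite /z; lra.
  have zy : z < y by rewrite /z; lra.
  have zm : rev x < rev z.
    by apply: revenue_lt_of_virtual_le0 => //; [lra|apply/ltW/phi_lt0; lra].
  apply: (lt_le_trans zm).
  move: ym; rewrite le_eqVlt => /predU1P[ym|ym].
    by rewrite ym max_m//; lra.
  apply/ltW/revenue_lt_of_virtual_le0 => //; [lra|lra|apply/ltW/phi_lt0; lra].
- pose z := (x + y) / 2.
  have phi_gt0 v : m < v -> v < 1 -> 0 < phi v.
    move=> mv v1; rewrite ltNge; apply/negP => /revenue_lt_of_virtual_le0.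
    by move=> /(_ m (ltW m0) mv v1); rewrite ltNge max_m//; lra.
  have xz : x < z by rewrite /z; lra.
  have zy : z < y by rewrite /z; lra.
  have zm : rev y < rev z.
    by apply: revenue_gt_of_virtual_ge0 => //; [lra|apply/ltW/phi_gt0; lra].
  apply: (lt_le_trans zm).
  move: mx; rewrite le_eqVlt => /predU1P[mx|mx].
    by rewrite -mx max_m//; lra.
  apply/ltW/revenue_gt_of_virtual_ge0 => //; [lra|lra|apply/ltW/phi_gt0; lra].
Qed.
End regular_revenue.

(** * Fragility-adjusted revenue as an expectation *)

Section bounded_random_variables.
Context {R : realType} (P0 : probability (measurableTypeR R) R).
Local Notation F := (CDF P0).

Lemma bounded_integrable (A : set R) (f : R -> R) (M : R) : measurable A ->
  measurable_fun A f -> (forall v, A v -> `|f v| <= M) ->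
  P0.-integrable A (EFin \o f).
Proof.
move=> mA mf fM; apply: measurable_bounded_integrable => //.
  by rewrite ltey_eq fin_num_measure.
exists M; split; first exact: num_real.
by move=> N MN v Av; apply: le_trans (fM v Av) (ltW MN).
Qed.

Lemma integrable_tail r x :
  P0.-integrable setT (EFin \o (fun v : R => r * (x < v)%R%:R)).
Proof.
apply: (@bounded_integrable _ _ `|r|) => //.
  apply: measurable_funM; first exact: measurable_cst.
  rewrite (_ : (fun v : R => (x < v)%R%:R) = \1_(`]x, +oo[%classic)).
    exact: measurable_indic.
  by apply/funext => v; rewrite indicE mem_setE in_itv/= andbT.
by move=> v _; case: (x < v); rewrite ?mulr1// mulr0 normr0.
Qed.

Lemma Rintegral_tail x : \int[P0]_v (x < v)%R%:R = 1 - F x.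
Proof.
rewrite (_ : (fun v : R => (x < v)%R%:R) = \1_(`]x, +oo[%classic)).
  rewrite /Rintegral integral_indic// setIT -[RHS]/(fine (_%:E)).
  by congr fine; exact: measure_itv_oy.
by apply/funext => v; rewrite indicE mem_setE in_itv/= andbT.
Qed.

Lemma Rintegral_step b c x y :
  \int[P0]_v (b * (x < v)%R%:R - c * (y < v)%R%:R) =
  b * (1 - F x) - c * (1 - F y).
Proof.
have tail_int z : P0.-integrable setT (EFin \o (fun v : R => (z < v)%R%:R)).
  by have := integrable_tail 1 z; under eq_fun do rewrite mul1r.
by rewrite RintegralB ?RintegralZl ?Rintegral_tail//; exact: integrable_tail.
Qed.

Lemma integrable_step b c x y : P0.-integrable setT
  (EFin \o (fun v : R => b * (x < v)%R%:R - c * (y < v)%R%:R)).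
Proof.
exact: (@integrableB _ _ _ P0 setT measurableT _ _
  (integrable_tail b x) (integrable_tail c y)).
Qed.

Definition fragility_payoff (k p v : R) : R :=
  Num.min p (k * Num.max (v - p) 0).

Lemma measurable_fragility_payoff k p :
  measurable_fun setT (fragility_payoff k p).
Proof.
apply: (@measurable_minr _ _ _ setT (cst p)); first exact: measurable_cst.
apply: measurable_funM; first exact: measurable_cst.
apply: (@measurable_maxr _ _ _ setT _ (cst 0)); last exact: measurable_cst.
exact: measurable_funB.
Qed.

Lemma fragility_payoff_bounded k p v : 0 < k -> 0 <= p ->
  `|fragility_payoff k p v| <= p.
Proof.
move=> k0 p0; rewrite ger0_norm; first by rewrite ge_min lexx.
by rewrite le_min p0 mulr_ge0 ?(ltW k0)// le_max lexx orbT.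
Qed.

Lemma fragility_payoff_integrable k p : 0 < k -> 0 <= p ->
  P0.-integrable setT (EFin \o fragility_payoff k p).
Proof.
move=> k0 p0; apply: (@bounded_integrable _ _ p) => //.
  exact: measurable_fragility_payoff.
by move=> v _; exact: fragility_payoff_bounded.
Qed.

Lemma fragility_payoffE k p v : 0 < k -> 0 <= p ->
  fragility_payoff k p v =
  if (1 + k^-1) * p < v then p else if p < v then k * v - k * p else 0.
Proof.
move=> k0 p0; rewrite /fragility_payoff -mulrBr.
have kinv : 0 < k^-1 by rewrite invr_gt0.
have pa : p <= (1 + k^-1) * p by nra.
have ka : k * ((1 + k^-1) * p - p) = p by field; rewrite gt_eqF.
have [av|va] := ltP ((1 + k^-1) * p) v.
  rewrite max_l; last by rewrite subr_ge0 (le_trans pa (ltW av)).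
  by rewrite min_l// -{1}ka ler_pM2l// lerD2r ltW.
have [pv|vp] := ltP p v; last by rewrite max_r ?subr_le0// mulr0 min_r.
rewrite max_l; last by rewrite subr_ge0 ltW.
by rewrite min_r// -{2}ka ler_pM2l// lerD2r.
Qed.

(** Raising the price from p to q gains at most q - p, for the values that pay
    the full price, and loses at most k (q - p), for the values between p and
    (1 + 1/k) q. The slope of the payoff in the price is
    (k + 1) 1_((1 + 1/k) p < v) - k 1_(p < v); each bound takes one indicator
    at p and the other at q. Being step functions of v, the bounds have
    expectations that involve the distribution function only. *)
Lemma fragility_payoff_increment k p q v : 0 < k -> 0 <= p -> p <= q ->
  (q - p) * ((k + 1) * ((1 + k^-1) * q < v)%R%:R - k * (p < v)%R%:R) <=
  fragility_payoff k q v - fragility_payoff k p v <=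
  (q - p) * ((k + 1) * ((1 + k^-1) * p < v)%R%:R - k * (q < v)%R%:R).
Proof.
move=> k0 p0 pq; have q0 := le_trans p0 pq.
have thr x : ((1 + k^-1) * x < v) = (k * x + x < k * v).
  rewrite -(ltr_pM2l k0) mulrA (_ : k * (1 + k^-1) * x = k * x + x)//.
  by field; rewrite gt_eqF.
have cmp x : (x < v) = (k * x < k * v) by rewrite ltr_pM2l.
have kpq : k * p <= k * q by rewrite ler_pM2l.
rewrite !fragility_payoffE// !thr (cmp q) (cmp p).
set K := k * v.
case: (ltP (k * q + q) K) => h1; case: (ltP (k * p + p) K) => h2;
case: (ltP (k * p) K) => h3; case: (ltP (k * q) K) => h4 /=; lra.
Qed.

End bounded_random_variables.

Section fragility.
Context {R : realType} (P0 : probability (measurableTypeR R) R) (p0 : R -> R).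
Context (hsupp : P0 `[0, 1]%classic = 1%E).
Context (hdens : is_density P0 p0).
Local Notation F := (CDF P0).
Local Notation rho := (fragility_revenue P0).

Lemma fragility_revenueE k p : 0 < k -> 0 <= p ->
  rho p k = \int[P0]_v fragility_payoff k p v.
Proof.
move=> k0 p_ge0; rewrite /fragility_revenue; set a := (1 + k^-1) * p.
have kinv : 0 < k^-1 by rewrite invr_gt0.
have pa : p <= a by rewrite /a; nra.
have ka : k * (a - p) = p by rewrite /a; field; rewrite gt_eqF.
have -> : \int[P0]_(v in `[a, 1]) p = p * (1 - F a).
  rewrite Rintegral_cst//; congr (_ * _).
  have [a1|a1] := leP a 1.
    have -> : 1 - F a = fine (F 1 - F a)%:E by rewrite (CDF_eq1 hsupp (lexx 1)).
    by congr fine; exact: (measure_itv_cc hdens a1).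
  rewrite (CDF_eq1 hsupp (ltW a1)) subrr set_itv_ge ?measure0//.
  by rewrite bnd_simp -ltNge.
have int_k : P0.-integrable `[p, a] (EFin \o (fun v => v - p)).
  apply: (@bounded_integrable _ P0 _ _ (a - p)) => //.
    exact: measurable_funB.
  move=> v /=; rewrite in_itv/= => /andP[pv va].
  by rewrite ger0_norm; lra.
rewrite -RintegralZl// Rintegral_mkcond.
(* The null term puts the tail in the form handled by [integrable_step]. *)
have -> : (fun v => k * (v - p)) \_ `[p, a] = (fun v =>
    fragility_payoff k p v - (p * (a < v)%R%:R - 0 * (a < v)%R%:R)).
  apply/funext => v; rewrite patchE mem_setE in_itv/= fragility_payoffE// -/a.
  have [av|va] := ltP a v; first by rewrite andbF /= mulr1 mul0r !subr0 subrr.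
  rewrite andbT mul0r mulr0 !subr0; case: (ltgtP p v) => [_|_|<-] //=.
    by rewrite mulrBr.
  by rewrite subrr mulr0.
rewrite RintegralB//; last 2 first.
- exact: fragility_payoff_integrable.
- exact: integrable_step.
by rewrite Rintegral_step; lra.
Qed.

Lemma fragility_revenue_increment k p q : 0 < k -> 0 <= p -> p <= q ->
  (q - p) * ((k + 1) * (1 - F ((1 + k^-1) * q)) - k * (1 - F p)) <=
  rho q k - rho p k <=
  (q - p) * ((k + 1) * (1 - F ((1 + k^-1) * p)) - k * (1 - F q)).
Proof.
move=> k0 p_ge0 pq; have q0 := le_trans p_ge0 pq.
rewrite !fragility_revenueE// -RintegralB//; last 2 first.
- exact: fragility_payoff_integrable.
- exact: fragility_payoff_integrable.
have increment v := fragility_payoff_increment v k0 p_ge0 pq.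
have int_incr : P0.-integrable setT
    (EFin \o (fun v => fragility_payoff k q v - fragility_payoff k p v)).
  exact: (@integrableB _ _ _ P0 setT measurableT _ _
    (fragility_payoff_integrable P0 k0 q0)
    (fragility_payoff_integrable P0 k0 p_ge0)).
apply/andP; split.
- rewrite mulrBr !mulrA -Rintegral_step; apply: le_Rintegral => //.
    exact: integrable_step.
  by move=> v _; case/andP: (increment v) => + _; rewrite mulrBr !mulrA.
- rewrite mulrBr !mulrA -Rintegral_step; apply: le_Rintegral => //.
    exact: integrable_step.
  by move=> v _; case/andP: (increment v) => _; rewrite mulrBr !mulrA.
Qed.

End fragility.

(** * Level sets of unimodal functions *)

Section unimodal_functions.
Context {R : realType} (f : R -> R) (m : R).
Context (cf : continuous f).
Context (m01 : 0 < m < 1).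
Context (f_incr : forall x y, 0 <= x -> x < y -> y <= m -> f x < f y).
Context (f_decr : forall x y, m <= x -> x < y -> y <= 1 -> f y < f x).

Lemma unimodal_le_max x : 0 <= x <= 1 -> f x <= f m.
Proof.
case/andP=> x0 x1; case: (ltgtP x m) => [xm|mx|->//]; apply/ltW.
  exact: f_incr.
exact: f_decr.
Qed.

Lemma unimodal_injl x y : 0 <= x <= m -> 0 <= y <= m -> f x = f y -> x = y.
Proof.
move=> /andP[x0 xm] /andP[y0 ym] fxy; case: (ltgtP x y) => // xy.
  by have := f_incr x0 xy ym; rewrite fxy ltxx.
by have := f_incr y0 xy xm; rewrite fxy ltxx.
Qed.

Lemma unimodal_injr x y : m <= x <= 1 -> m <= y <= 1 -> f x = f y -> x = y.
Proof.
move=> /andP[mx x1] /andP[my y1] fxy; case: (ltgtP x y) => // xy.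
  by have := f_decr mx xy y1; rewrite fxy ltxx.
by have := f_decr my xy x1; rewrite fxy ltxx.
Qed.

(** Each level is reached on either side of the peak, by the intermediate value
    theorem; the branches are then obtained by choice. *)
Lemma unimodal_branches : f 0 = 0 -> f 1 = 0 -> exists u w : R -> R,
  forall c, 0 <= c <= f m ->
    [/\ 0 <= u c <= m, m <= w c <= 1, f (u c) = c & f (w c) = c].
Proof.
move=> f0 f1; case/andP: m01 => m0 m1.
have fm0 : 0 < f m by rewrite -f0 f_incr.
have left c : exists x, 0 <= c <= f m -> 0 <= x <= m /\ f x = c.
  have [cm|_] := boolP (0 <= c <= f m); last by exists 0.
  have [||x x0m fx] := @IVT _ f 0 m c (ltW m0).
  - exact/continuous_subspaceT.
  - by rewrite f0 min_l ?max_r ?(ltW fm0).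
  by exists x.
have right c : exists x, 0 <= c <= f m -> m <= x <= 1 /\ f x = c.
  have [cm|_] := boolP (0 <= c <= f m); last by exists 0.
  have [||x xm1 fx] := @IVT _ f m 1 c (ltW m1).
  - exact/continuous_subspaceT.
  - by rewrite f1 min_r ?max_l ?(ltW fm0).
  by exists x.
have [u uP] := choice left; have [w wP] := choice right.
by exists u, w => c cm; have [? ?] := uP c cm; have [? ?] := wP c cm; split.
Qed.

(** The gap f p - f (a p) is nonpositive when a p is the peak, and nonnegative
    when a p = 1, so it vanishes in between. At such a zero h the peak lies
    strictly between h and a h. If p < h, either a p is still on the increasing
    side, or f p < f h = f (a h) < f (a p); symmetrically beyond h. *)
Lemma unimodal_crossing a : 1 < a -> f 0 = 0 -> (forall x, 1 <= x -> f x = 0) ->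
  exists h, [/\ 0 < h, h < m, m < a * h <= 1 & f h = f (a * h)] /\
    (forall p, 0 < p -> p < h -> f p < f (a * p)) /\
    (forall p, h < p -> p < 1 -> f (a * p) < f p).
Proof.
move=> a1 f0 f_ge1; case/andP: m01 => m0 m1.
have a0 : 0 < a by lra.
have ia : a * a^-1 = 1 by rewrite mulfV// gt_eqF.
have ia0 : 0 < a^-1 by rewrite invr_gt0.
have am : a * (m * a^-1) = m by rewrite mulrCA ia mulr1.
have fpos x : 0 < x -> x < 1 -> 0 < f x.
  move=> x0 x1; have [xm|/ltW mx] := leP x m; first by rewrite -f0 f_incr.
  by rewrite -(f_ge1 1)// f_decr.
have [|||h] := @IVT _ (fun p => f p - f (a * p)) (m * a^-1) a^-1 0.
- by nra.
- apply: continuous_subspaceT => x; apply: cvgB; first exact: cf.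
  apply: (@continuous_comp _ _ _ ( *%R a) f); last exact: cf.
  by apply: cvgM; [exact: cvg_cst|exact: cvg_id].
- have fl : f (m * a^-1) - f m <= 0.
    by rewrite subr_le0 ltW// f_incr//; nra.
  have fr : 0 <= f a^-1 - f 1.
    by rewrite (f_ge1 1)// subr0 ltW// fpos//; nra.
  by rewrite am ia min_l ?max_r// ?fl ?fr// (le_trans fl fr).
rewrite in_itv/= => /andP[hl hr] /eqP; rewrite subr_eq0 => /eqP fh.
have h0 : 0 < h by nra.
have ah1 : a * h <= 1 by nra.
have hah : h < a * h by nra.
have hm : h < m.
  rewrite ltNge; apply/negP => mh.
  by have := f_decr mh hah ah1; rewrite fh ltxx.
have mah : m < a * h.
  rewrite ltNge; apply/negP => ahm.
  by have := f_incr (ltW h0) hah ahm; rewrite fh ltxx.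
exists h; split; first by rewrite h0 hm mah.
split=> p.
- move=> p0 ph; have pap : p < a * p by nra.
  have apah : a * p < a * h by rewrite ltr_pM2l.
  have [apm|map] := leP (a * p) m; first by apply: f_incr => //; exact: ltW.
  apply: (@lt_trans _ _ (f h)); first by apply: f_incr => //; exact: ltW.
  by rewrite fh f_decr// ltW.
- move=> hp p1; have pap : p < a * p by nra.
  have apah : a * h < a * p by rewrite ltr_pM2l.
  have [ap1|ap1] := leP 1 (a * p); first by rewrite f_ge1// fpos//; lra.
  have [mp|pm] := leP m p; first by apply: f_decr => //; exact: ltW.
  apply: (@lt_trans _ _ (f h)); last by apply: f_incr => //; exact: ltW.
  by rewrite fh f_decr// ltW.
Qed.
End unimodal_functions.

(** * Maximizing the fragility-adjusted revenue *)

Section fragility_optimum.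
Context {R : realType} (P0 : probability (measurableTypeR R) R) (p0 : R -> R).
Context (hsupp : P0 `[0, 1]%classic = 1%E).
Context (hdens : is_density P0 p0).
Context (k : R).
Context (k0 : 0 < k).
Local Notation F := (CDF P0).
Local Notation rev := (revenue P0).
Local Notation a := (1 + k^-1).
Local Notation rho p := (fragility_revenue P0 p k).

(** The marginal gain (k + 1) S(a p) is evaluated at the right end of each
    subinterval and the marginal loss k S(p) at the left end; moving the
    latter to the right end costs a second-order error. *)
Lemma fragility_homo x y : 0 <= x -> x <= y ->
  (forall p, x < p -> p <= y -> k * (1 - F p) <= (k + 1) * (1 - F (a * p))) ->
  rho x <= rho y.
Proof.
move=> x0 xy marg.
apply: (le_of_bisection (f := fun p => rho p) (g := fun p => k * F p) xy).
move=> s t xs st ty.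
move: st; rewrite le_eqVlt => /predU1P[->|st]; first by rewrite !subrr mul0r.
have := marg t (le_lt_trans xs st) ty.
have /andP[+ _] := fragility_revenue_increment hsupp hdens k0
  (le_trans x0 xs) (ltW st).
nra.
Qed.

Lemma fragility_anti x y : 0 <= x -> x <= y ->
  (forall p, x <= p -> p < y -> (k + 1) * (1 - F (a * p)) <= k * (1 - F p)) ->
  rho y <= rho x.
Proof.
move=> x0 xy marg; rewrite -lerN2.
apply: (le_of_bisection (f := fun p => - rho p) (g := fun p => k * F p) xy).
move=> s t xs st ty.
move: st; rewrite le_eqVlt => /predU1P[->|st]; first by rewrite !subrr mul0r.
have := marg s xs (lt_le_trans st ty).
have /andP[_ +] := fragility_revenue_increment hsupp hdens k0
  (le_trans x0 xs) (ltW st).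
nra.
Qed.

(** By continuity of F, the strict inequality at z survives when the loss term
    is evaluated slightly to the left of z; there a single increment bound
    gives strict growth. *)
Lemma fragility_lt x z : 0 <= x -> x < z ->
  (forall p, x < p -> p <= z -> k * (1 - F p) <= (k + 1) * (1 - F (a * p))) ->
  k * (1 - F z) < (k + 1) * (1 - F (a * z)) -> rho x < rho z.
Proof.
move=> x0 xz marg Dz.
have cS : k * (1 - F y) @[y --> z^'-] --> k * (1 - F z).
  apply: cvg_at_left_filter; apply: cvgM; first exact: cvg_cst.
  by apply: cvgB; [exact: cvg_cst|exact: (CDF_continuous hdens)].
have [y /andP[xy yz] Dy] :
    exists2 y, x < y < z & k * (1 - F y) < (k + 1) * (1 - F (a * z)).
  near z^'- => y; exists y.
    by apply/andP; split; [near: y; exact: nbhs_left_gt|].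
  by near: y; exact: cvgr_lt cS _ Dz.
apply: (@le_lt_trans _ _ (rho y)).
  apply: fragility_homo => // [|p xp py]; first exact: ltW.
  by apply: marg => //; rewrite (le_trans py)// ltW.
have /andP[+ _] := fragility_revenue_increment hsupp hdens k0
  (le_trans x0 (ltW xy)) (ltW yz).
nra.
Unshelve. all: by end_near. Qed.

Lemma fragility_gt z y : 0 <= z -> z < y ->
  (forall p, z <= p -> p < y -> (k + 1) * (1 - F (a * p)) <= k * (1 - F p)) ->
  (k + 1) * (1 - F (a * z)) < k * (1 - F z) -> rho y < rho z.
Proof.
move=> z0 zy marg Dz.
have cS : k * (1 - F x) @[x --> z^'+] --> k * (1 - F z).
  apply: cvg_at_right_filter; apply: cvgM; first exact: cvg_cst.
  by apply: cvgB; [exact: cvg_cst|exact: (CDF_continuous hdens)].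
have [x /andP[zx xy] Dx] :
    exists2 x, z < x < y & (k + 1) * (1 - F (a * z)) < k * (1 - F x).
  near z^'+ => x; exists x.
    by apply/andP; split; [|near: x; exact: nbhs_right_lt].
  by near: x; exact: cvgr_gt cS _ Dz.
apply: (@le_lt_trans _ _ (rho x)).
  apply: fragility_anti => // [||p xp py]; [lra|exact: ltW|].
  by apply: marg => //; rewrite (le_trans _ xp)// ltW.
have /andP[_ +] := fragility_revenue_increment hsupp hdens k0
  z0 (ltW zx).
nra.
Unshelve. all: by end_near. Qed.

(** The key identity: p rho'(p) is k times the revenue gap between the prices
    a p and p. *)
Lemma revenue_gap p :
  p * ((k + 1) * (1 - F (a * p)) - k * (1 - F p)) = k * (rev (a * p) - rev p).
Proof. by rewrite /revenue; field; rewrite gt_eqF. Qed.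

Lemma fragility_marginal_ge p : 0 < p ->
  (k * (1 - F p) <= (k + 1) * (1 - F (a * p))) = (rev p <= rev (a * p)).
Proof.
by move=> p_gt0; rewrite -subr_ge0 -(pmulr_rge0 _ p_gt0) revenue_gap
  pmulr_rge0// subr_ge0.
Qed.

Lemma fragility_marginal_le p : 0 < p ->
  ((k + 1) * (1 - F (a * p)) <= k * (1 - F p)) = (rev (a * p) <= rev p).
Proof.
by move=> p_gt0; rewrite -subr_le0 -(pmulr_rle0 _ p_gt0) revenue_gap
  pmulr_rle0// subr_le0.
Qed.

Lemma fragility_maximum h q : 0 < h -> h < 1 -> rev h = rev (a * h) ->
  (forall p, 0 < p -> p < h -> rev p < rev (a * p)) ->
  (forall p, h < p -> p < 1 -> rev (a * p) < rev p) ->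
  0 <= q <= 1 -> q != h -> rho q < rho h.
Proof.
move=> h0 h1 fh below above /andP[q0 q1]; rewrite neq_lt => /orP[qh|hq].
- pose z := (q + h) / 2.
  have qz : q < z by rewrite /z; lra.
  have zh : z < h by rewrite /z; lra.
  have z0 : 0 < z by lra.
  have marg p : 0 < p -> p <= h -> k * (1 - F p) <= (k + 1) * (1 - F (a * p)).
    move=> p_gt0; rewrite fragility_marginal_ge// le_eqVlt => /predU1P[->|ph].
      by rewrite fh.
    exact/ltW/below.
  apply: (@lt_le_trans _ _ (rho z)).
    apply: fragility_lt => // [p qp pz|]; first by apply: marg; lra.
    by rewrite ltNge fragility_marginal_le// -ltNge below.
  by apply: fragility_homo => [||p zp ph]; [lra|lra|apply: marg; lra].
- pose z := (h + q) / 2.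
  have hz : h < z by rewrite /z; lra.
  have zq : z < q by rewrite /z; lra.
  have z0 : 0 < z by lra.
  have marg p : h <= p -> p < 1 -> (k + 1) * (1 - F (a * p)) <= k * (1 - F p).
    move=> hp p1; rewrite fragility_marginal_le; last lra.
    move: hp; rewrite le_eqVlt => /predU1P[<-|hp]; first by rewrite fh.
    exact/ltW/above.
  apply: (@lt_le_trans _ _ (rho z)).
    apply: fragility_gt => // [|p zp pq|]; [lra|by apply: marg; lra|].
    by rewrite ltNge fragility_marginal_ge// -ltNge above//; lra.
  by apply: fragility_anti => [||p hp pz]; [lra|lra|apply: marg; lra].
Qed.
End fragility_optimum.

Theorem proposition4 (R : realType)
    (P0 : probability (measurableTypeR R) R) (p0 : R -> R)
    (hsupp : P0 `[0, 1]%classic = 1%E)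
    (hdens : is_density P0 p0)
    (hreg : regular P0 p0) :
  exists u w : R -> R,
    [/\ forall c, 0 <= c <= max_revenue P0 ->
          u c <= w c /\ prices P0 c = [set u c; w c],
        forall c c', 0 <= c -> c < c' -> c' <= max_revenue P0 ->
          (price_ratio u w c' < price_ratio u w c)%E
      & forall k : R, 0 < k ->
          exists cs : R,
            unique (fun c => 0 <= c <= max_revenue P0 /\
                             price_ratio u w c = ((k + 1) / k)%:E) cs /\
            argmax_price P0 k = [set u cs]].
Proof.
have [m m01 [incr decr]] := revenue_unimodal hsupp hdens hreg.
have rev_cont := revenue_continuous hdens.
have rev0 : revenue P0 0 = 0 by rewrite /revenue mul0r.
have rev_ge1 := revenue_ge1 hsupp.
have /andP[m_gt0 m_lt1] := m01.
have max_m := unimodal_le_max incr decr.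
have -> : max_revenue P0 = revenue P0 m.
  have ub : ubound (revenue P0 @` `[0, 1]%classic) (revenue P0 m).
    by move=> _ [x x01 <-]; apply: max_m; move: x01; rewrite /= in_itv.
  have im : (revenue P0 @` `[0, 1]%classic) (revenue P0 m).
    by exists m => //; rewrite /= in_itv /= !ltW.
  apply/eqP; rewrite eq_le ge_sup//=; last by exists (revenue P0 m).
  by apply: ub_le_sup => //; exists (revenue P0 m).
have [u [w uw]] :=
  unimodal_branches rev_cont m01 incr rev0 (rev_ge1 _ (lexx 1)).
have ratio_decr c c' : 0 <= c -> c < c' -> c' <= revenue P0 m ->
    (price_ratio u w c' < price_ratio u w c)%E.
  move=> c0 cc' c'm.
  have [|/andP[u0 um] /andP[mw w1] fu fw] := uw c.
    by rewrite c0 (le_trans (ltW cc')).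
  have [|/andP[u0' um'] /andP[mw' w1'] fu' fw'] := uw c'.
    by rewrite c'm (le_trans c0 (ltW cc')).
  have ucc' : u c < u c'.
    rewrite ltNge; apply/negP; rewrite le_eqVlt => /predU1P[E|lt].
      by move: cc'; rewrite -fu -fu' E ltxx.
    by have := incr _ _ u0' lt um; rewrite fu fu' ltNge (ltW cc').
  have wcc' : w c' < w c.
    rewrite ltNge; apply/negP; rewrite le_eqVlt => /predU1P[E|lt].
      by move: cc'; rewrite -fw -fw' E ltxx.
    by have := decr _ _ mw lt w1'; rewrite fw fw' ltNge (ltW cc').
  have uc'0 : 0 < u c' by lra.
  have wc0 : 0 < w c by lra.
  rewrite /price_ratio (gt_eqF uc'0) wc0 andbT /=.
  case: eqVneq => [_|uc_neq0]; first exact: ltry.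
  have uc0 : 0 < u c by rewrite lt_neqAle eq_sym uc_neq0.
  rewrite lte_fin ltr_pdivrMr// mulrAC ltr_pdivlMr//.
  nra.
exists u, w; split=> // [c cm|k k0].
  have [/andP[u0 um] /andP[mw w1] fu fw] := uw c cm.
  split; first exact: le_trans um mw.
  apply/seteqP; split=> [p [/andP[p_ge0 p1] fp]|p [->|->]] /=.
  - have [pm|/ltW mp] := leP p m; [left|right].
      by apply: (unimodal_injl incr); rewrite ?fp ?p_ge0 ?u0.
    by apply: (unimodal_injr decr); rewrite ?fp ?mp ?mw.
  - by split=> //; rewrite u0 (le_trans um (ltW m_lt1)).
  - by split=> //; rewrite w1 (le_trans (ltW m_gt0) mw).
have kinv : 0 < k^-1 by rewrite invr_gt0.
have a1 : 1 < 1 + k^-1 by lra.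
have [h [[h0 hm /andP[mah ah1] fh] [below above]]] :=
  unimodal_crossing rev_cont m01 incr decr a1 rev0 rev_ge1.
have revh : 0 <= revenue P0 h <= revenue P0 m.
  rewrite max_m; last lra.
  by rewrite -rev0 ltW// incr// ltW.
have [u0m wm1 fu fw] := uw _ revh.
have uh : u (revenue P0 h) = h.
  by apply: (unimodal_injl incr) => //; rewrite !ltW.
have wh : w (revenue P0 h) = (1 + k^-1) * h.
  by apply: (unimodal_injr decr) => //; rewrite ?fw ?ah1 ?ltW.
exists (revenue P0 h); split.
  split=> [|c [/andP[c0 cm] ratio_c]].
    split=> //; rewrite /price_ratio uh wh (gt_eqF h0) /= mulfK ?gt_eqF//.
    by congr EFin; field; rewrite gt_eqF.
  have ratio_h : price_ratio u w (revenue P0 h) = ((k + 1) / k)%:E.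
    rewrite /price_ratio uh wh (gt_eqF h0) /= mulfK ?gt_eqF//.
    by congr EFin; field; rewrite gt_eqF.
  case/andP: revh => revh0 revhm.
  case: (ltgtP (revenue P0 h) c) => // lt.
    by have := ratio_decr _ _ revh0 lt cm; rewrite ratio_c ratio_h ltxx.
  by have := ratio_decr _ _ c0 lt revhm; rewrite ratio_c ratio_h ltxx.
have h1 : h < 1 by lra.
have best q := fragility_maximum (q := q) hsupp hdens k0 h0 h1 fh below above.
rewrite uh; apply/seteqP; split=> [p [p01 p_max]|_ ->] /=.
  apply: contrapT => /eqP /(best p p01); rewrite ltNge p_max//.
  by rewrite !ltW.
split=> [|q q01]; first by rewrite !ltW.
by have [->//|/(best q q01)/ltW] := eqVneq q h.
Qed.
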